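(* For a monoid $M$, the following sets are in bijective correspondence: (i) the set of left normal factorizations $(A,B)$ of $M$ whose first factor $A$ is a group; (ii) the set of left normal descent 1-cocycles $q : M \to A$ with domain $M$ and codomain a group $A$; (iii) the set of split epimorphisms $(p,s)$ of monoids with domain $M$, that is, monoid homomorphisms $p : M \to B$ and $s : B \to M$ with $p s = \mathrm{Id}_B$, satisfying the condition: for all $m_1, m_2 \in M$ with $p(m_1) = p(m_2)$ there exists a unique $k \in \mathrm{Ker}(p)$ with $m_2 = k m_1$. These bijective correspondences are given explicitly as follows. From (i) to (ii): $(A,B) \mapsto l^B_A$, with inverse $q \mapsto (A, \mathrm{Ker}(q))$. From (ii) to (iii): $q \mapsto (q^\dagger, \imath_{\mathrm{Ker}(q)})$, with inverse $(p,s) \mapsto l^{s(B)}_{\mathrm{Ker}(p)}$.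
   Context: Let $1_M$ be the unit of $M$. A pair $(A,B)$ of submonoids of $M$ is a factorization of $M$ if the multiplication map $A \times B \to M$, $(a,b)\mapsto ab$, is bijective; then $l^B_A : M \to A$ is the map sending $m = ab$ (unique decomposition with $a\in A$, $b\in B$) to $a$. For a subset $X \subseteq M$, a submonoid $N$ of $M$ is left $X$-normal if $xN \subseteq Nx$ for all $x \in X$. A factorization $(A,B)$ is left normal if $A$ is left $B$-normal. For a submonoid $A$ of $M$, a (left) descent 1-cocycle is a map of sets $q : M \to A$ such that (L1) $q(a) = a$ for all $a \in A$; (L2) $q(am) = a\,q(m)$ for all $a \in A$, $m \in M$; (L3) $q(m_1 m_2) = q(m_1 q(m_2))$ for all $m_1, m_2 \in M$. $\mathrm{Ker}(q) = \{m \in M : q(m) = 1_M\}$, which is a submonoid of $M$. The descent 1-cocycle $q$ is left normal if $A$ is left $\mathrm{Ker}(q)$-normal. If $A$ is a group, $q^\dagger : M \to \mathrm{Ker}(q)$ is the map $m \mapsto q(m)^{-1} m$, and $\imath_{\mathrm{Ker}(q)} : \mathrm{Ker}(q) \hookrightarrow M$ is the inclusion. For a monoid homomorphism $p : M \to B$, $\mathrm{Ker}(p) = \{m \in M : p(m) = 1_B\}$, where $1_B$ is the unit of $B$.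
   Formalization: In (iii), split epimorphisms (p,s) are taken up to isomorphism of the codomain B compatible with p and s; literal equality fails, since e.g. for trivial M every one-element monoid B gives a distinct pair (p,s). *)

(* Defs.v *)
From HB Require Import structures.
From mathcomp Require Import all_boot.
From mathcomp Require Import boolp classical_sets.

Set Implicit Arguments.
Unset Strict Implicit.
Unset Printing Implicit Defensive.

Local Open Scope classical_set_scope.
Local Open Scope group_scope.

(* Submonoids of M are the library's [umagmaClosed M] (predicates closed under
   the product and containing 1); [submon A] is A as a monoid. *)
Definition submon (M : monoidType) (A : umagmaClosed M) : Type :=
  {x : M | x \in A}.

HB.instance Definition _ (M : monoidType) (A : umagmaClosed M) :=
  SubChoice.copy (submon A) {x : M | x \in A}.

Lemma submon_closed (M : monoidType) (A : umagmaClosed M) :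
  monoid_closed (fun x : M => x \in A).
Proof. by split=> [|x y xA yA]; [exact: gpred1 | exact: gpredM]. Qed.

HB.instance Definition _ (M : monoidType) (A : umagmaClosed M) :=
  SubChoice_isSubMonoid.Build M (fun x : M => x \in A) (submon A)
    (submon_closed A).

Definition submonoid_of (M : monoidType) (P : {pred M}) (hP : monoid_closed P) :
    umagmaClosed M :=
  HB.pack P (isMul1Closed.Build M P hP.1) (isMulClosed.Build M P hP.2).

Definition is_group (G : monoidType) : Prop :=
  forall x : G, exists y : G, y * x = 1 /\ x * y = 1.

Definition left_normal (M : monoidType) (X : {pred M}) (N : umagmaClosed M) :
    Prop :=
  forall x : M, x \in X ->
    [set x * n | n in [set` N]] `<=` [set n * x | n in [set` N]].

Definition factorization (M : monoidType) (A B : umagmaClosed M) : Prop :=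
  bijective (fun ab : submon A * submon B => val ab.1 * val ab.2).

(* The map l^B_A; the default value 1 of [xget] is irrelevant when (A, B) is a
   factorization, since then exactly one a qualifies. *)
Definition lproj (M : monoidType) (A B : umagmaClosed M) (m : M) : submon A :=
  xget 1 [set a : submon A | exists b : submon B, m = val a * val b].

Arguments lproj {M} A B m.

(* Used both for homomorphisms and for descent 1-cocycles. *)
Definition Ker (M N : monoidType) (f : M -> N) : {pred M} :=
  fun m => f m == 1.

Definition descent_cocycle (M : monoidType) (A : umagmaClosed M)
    (q : M -> submon A) : Prop :=
  [/\ forall a : submon A, q (val a) = a,
      forall (a : submon A) (m : M), q (val a * m) = a * q m
    & forall m1 m2 : M, q (m1 * m2) = q (m1 * val (q m2))].

Definition split_epi (M B : monoidType) (p : M -> B) (s : B -> M) : Prop :=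
  [/\ monoid_morphism p, monoid_morphism s & cancel s p].

Definition kernel_torsor (M B : monoidType) (p : M -> B) : Prop :=
  forall m1 m2 : M, p m1 = p m2 ->
    exists! k : M, k \in Ker p /\ m2 = k * m1.

Record lnFactorization (M : monoidType) := LNFactorization {
  factors : umagmaClosed M * umagmaClosed M;
  _ : factorization factors.1 factors.2;
  _ : left_normal factors.2 factors.1;
  _ : is_group (submon factors.1)
}.

(* A map from M to a submonoid of M, recorded together with its codomain. *)
Record mapToSub (M : monoidType) := MapToSub {
  target : umagmaClosed M;
  mapq :> M -> submon target
}.

Record lnCocycle (M : monoidType) := LNCocycle {
  cocycle_map :> mapToSub M;
  lnCocycleP : descent_cocycle cocycle_map;
  _ : left_normal (Ker cocycle_map) (target cocycle_map);
  lnCocycle_group : is_group (submon (target cocycle_map))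
}.

Record splitData (M : monoidType) := SplitData {
  base : monoidType;
  proj : M -> base;
  sect : base -> M
}.

Arguments sect {M} s.

Record splitEpi (M : monoidType) := SplitEpi {
  split_data :> splitData M;
  splitEpiP : split_epi (proj split_data) (sect split_data);
  _ : kernel_torsor (proj split_data)
}.

(* Split epimorphisms with domain M whose codomains vary are compared up to
   isomorphism of the codomains compatible with both p and s. *)
Definition split_iso (M : monoidType) (e e' : splitEpi M) : Prop :=
  exists phi : base e -> base e',
    [/\ bijective phi, monoid_morphism phi,
        forall m : M, phi (proj e m) = proj e' m
      & forall b : base e, sect e' (phi b) = sect e b].

Lemma KerC_closed (M : monoidType) (q : lnCocycle M) : monoid_closed (Ker q).
Proof.
have [L1 L2 L3] := lnCocycleP q.
split=> [|x y]; rewrite !unfold_in /=.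
  by apply/eqP; rewrite -[RHS]L1 val1.
by move=> /eqP qx /eqP qy; rewrite L3 qy val1 mulg1 qx.
Qed.

Definition KerC (M : monoidType) (q : lnCocycle M) : umagmaClosed M :=
  submonoid_of (KerC_closed q).

Definition cocycle_inv (M : monoidType) (q : lnCocycle M) (m : M) :
    submon (target q) :=
  sval (cid (lnCocycle_group (q m))).

Lemma dagger_subproof (M : monoidType) (q : lnCocycle M) (m : M) :
  val (cocycle_inv q m) * m \in KerC q.
Proof.
have [_ L2 _] := lnCocycleP q; rewrite unfold_in /= L2.
by apply/eqP; rewrite /cocycle_inv; case: cid => y [].
Qed.

(* m |-> q(m)^-1 m *)
Definition dagger (M : monoidType) (q : lnCocycle M) (m : M) :
    submon (KerC q) :=
  Sub (val (cocycle_inv q m) * m) (dagger_subproof q m).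

Lemma KerP_closed (M : monoidType) (e : splitEpi M) :
  monoid_closed (Ker (proj e)).
Proof.
have [[p1 pM] _ _] := splitEpiP e.
split=> [|x y]; rewrite !unfold_in /=; first by rewrite p1.
by move=> /eqP px /eqP py; rewrite pM px py mulg1.
Qed.

Definition KerP (M : monoidType) (e : splitEpi M) : umagmaClosed M :=
  submonoid_of (KerP_closed e).

Definition im_sect (M : monoidType) (e : splitEpi M) : {pred M} :=
  fun m => `[< range (sect e) m >].

Lemma ImS_closed (M : monoidType) (e : splitEpi M) : monoid_closed (im_sect e).
Proof.
have [_ [s1 sM] _] := splitEpiP e.
split=> [|x y]; rewrite !unfold_in /=; first by apply/asboolP; exists 1.
move=> /asboolP[b _ <-] /asboolP[c _ <-]; apply/asboolP.
by exists (b * c) => //; rewrite sM.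
Qed.

Definition ImS (M : monoidType) (e : splitEpi M) : umagmaClosed M :=
  submonoid_of (ImS_closed e).

(* Main.v *)
Require Import Defs.
From HB Require Import structures.
From mathcomp Require Import all_boot.
From mathcomp Require Import boolp classical_sets.

(** Everything is read off the decomposition [m = a * b].  A descent 1-cocycle
    [q] with values in a group gives [m = q m * (q m)^-1 m], whose second factor
    lies in [Ker q], and a split epimorphism [(p, s)] whose fibres are torsors
    under [Ker p] gives [m = k * s (p m)] with [k] in [Ker p].  Left normality
    moves [b1] past [a2] in [a1 b1 a2 b2 = a1 a' b1 b2], which is exactly the
    multiplicativity of [m |-> b]. *)

Set Implicit Arguments.
Unset Strict Implicit.
Unset Printing Implicit Defensive.

Local Open Scope classical_set_scope.
Local Open Scope group_scope.

(** * Equality of bundled structures from equality of their data *)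

Lemma umagmaClosed_ext (M : monoidType) (A B : umagmaClosed M) :
  A =i B -> A = B.
Proof.
case: A B => [A cA] [B cB] eqAB.
have eqf : A = B by apply/funext=> x; exact: eqAB.
(* Once both predicates are the same term, the two families of closure proofs have the same types
   and proof irrelevance applies. *)
move: cA cB {eqAB}; rewrite eqf => -[[hA] [h1A]] [[hB] [h1B]].
by rewrite (Prop_irrelevance hA hB) (Prop_irrelevance h1A h1B).
Qed.

Lemma lnFactorization_ext (M : monoidType) (f g : lnFactorization M) :
  factors f = factors g -> f = g.
Proof.
case: f g => [f fF fN fG] [g gF gN gG] /= eqfg; move: gF gN gG; rewrite -eqfg.
by move=> gF gN gG; congr LNFactorization; exact: Prop_irrelevance.
Qed.

Lemma lnCocycle_ext (M : monoidType) (q r : lnCocycle M) :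
  cocycle_map q = cocycle_map r -> q = r.
Proof.
case: q r => [q qF qN qG] [r rF rN rG] /= eqqr; move: rF rN rG; rewrite -eqqr.
by move=> rF rN rG; congr LNCocycle; exact: Prop_irrelevance.
Qed.

(** * Factorizations and their left projections *)

Section Factorization.
Variables (M : monoidType) (A B : umagmaClosed M).

Lemma factorizationI :
    (forall m, exists (a : submon A) (b : submon B), m = val a * val b) ->
    (forall (a a' : submon A) (b b' : submon B),
       val a * val b = val a' * val b' -> a = a' /\ b = b') ->
  factorization A B.
Proof.
move=> ex_ab uniq_ab.
have ex_pair m : exists ab : submon A * submon B, val ab.1 * val ab.2 = m.
  by have [a [b ->]] := ex_ab m; exists (a, b).
(* A chosen decomposition of each element is the inverse of multiplication. *)
have [g gK] := choice ex_pair.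
exists g => // -[a b] /=.
by have := gK (val a * val b); case: (g _) => a' b' /= /uniq_ab[-> ->].
Qed.

Hypothesis factAB : factorization A B.

Lemma factorization_inj (a a' : submon A) (b b' : submon B) :
  val a * val b = val a' * val b' -> a = a' /\ b = b'.
Proof.
by move=> eqab; have [] := bij_inj factAB (eqab : _ (a, b) = _ (a', b')).
Qed.

Lemma factorization_ex (m : M) :
  exists (a : submon A) (b : submon B), m = val a * val b.
Proof. by have [g _ gK] := factAB; exists (g m).1, (g m).2; rewrite gK. Qed.

Lemma lprojM (a : submon A) (b : submon B) : lproj A B (val a * val b) = a.
Proof.
(* Uniqueness identifies the element picked by [xget] with [a]; the pair [a], [b] itself rules out
   the default branch. *)
rewrite /lproj; case: xgetP => [a' _ [b' /factorization_inj[]]|/(_ a)[]] //.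
by exists b.
Qed.

Lemma lproj_val (a : submon A) : lproj A B (val a) = a.
Proof. by rewrite -[val a]mulg1 -(val1 (submon B)) lprojM. Qed.

Lemma Ker_lproj : Ker (lproj A B) =i B.
Proof.
move=> m; rewrite unfold_in /=; apply/eqP/idP => [|mB].
  have [a [b ->]] := factorization_ex m; rewrite lprojM => ->.
  by rewrite val1 mul1g; exact: valP.
by rewrite -[m]mul1g -(val1 (submon A)) -[m](SubK (submon B) mB) lprojM.
Qed.

Lemma lproj_cocycle : descent_cocycle (lproj A B).
Proof.
split=> [|a m|m1 m2]; first exact: lproj_val.
  by have [a' [b ->]] := factorization_ex m; rewrite mulgA -valM !lprojM.
(* With [m2 = a2 * b2] and [m1 * a2 = a * b], one gets [m1 * m2 = a * (b * b2)], so both sides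
   project to [a]. *)
have [a2 [b2 ->]] := factorization_ex m2; rewrite lprojM mulgA.
have [a [b ->]] := factorization_ex (m1 * val a2).
by rewrite -mulgA -valM !lprojM.
Qed.

End Factorization.

(** * Left normality and the cocycle of a factorization *)

Lemma left_normal_eq (M : monoidType) (X Y : {pred M}) (N : umagmaClosed M) :
  X =i Y -> left_normal X N -> left_normal Y N.
Proof. by move=> eqXY nXN x; rewrite -eqXY; exact: nXN. Qed.

Lemma left_normalP (M : monoidType) (X : {pred M}) (N : umagmaClosed M)
    (x : M) (n : submon N) :
  left_normal X N -> x \in X -> exists n' : submon N, x * val n = val n' * x.
Proof.
move=> nXN xX.
have [|n' n'N <-] := nXN x xX (x * val n).
  by exists (val n) => //; exact: valP.
by exists (Sub n' n'N).
Qed.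

Definition cocycle_of_factorization (M : monoidType) (f : lnFactorization M) :
  lnCocycle M :=
  let: LNFactorization AB fAB nAB gA := f in
  @LNCocycle M (MapToSub (lproj AB.1 AB.2)) (lproj_cocycle fAB)
    (left_normal_eq (fun m => esym (Ker_lproj fAB m)) nAB) gA.

Lemma cocycle_of_factorizationE (M : monoidType) (f : lnFactorization M) :
  cocycle_map (cocycle_of_factorization f)
  = MapToSub (lproj (factors f).1 (factors f).2).
Proof. by case: f. Qed.

Lemma cocycle_left_normal (M : monoidType) (q : lnCocycle M) :
  left_normal (Ker q) (target q).
Proof. by case: q. Qed.

(** * The factorization and the split epimorphism of a cocycle *)

Section Cocycle.
Variables (M : monoidType) (q : lnCocycle M).

Lemma cocycle_invV (m : M) :
  cocycle_inv q m * q m = 1 /\ q m * cocycle_inv q m = 1.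
Proof. by rewrite /cocycle_inv; case: cid. Qed.

Lemma cocycleM_Ker (a : submon (target q)) (b : submon (KerC q)) :
  q (val a * val b) = a.
Proof.
have [_ qM _] := lnCocycleP q; rewrite qM.
by have /eqP -> : q (val b) == 1 := valP b; rewrite mulg1.
Qed.

Lemma cocycle_dagger (m : M) : m = val (q m) * val (dagger q m).
Proof.
by rewrite SubK mulgA -valM; have [_ ->] := cocycle_invV m; rewrite val1 mul1g.
Qed.

Lemma daggerM_Ker (a : submon (target q)) (b : submon (KerC q)) :
  dagger q (val a * val b) = b.
Proof.
apply: val_inj; rewrite SubK mulgA -valM.
have [+ _] := cocycle_invV (val a * val b).
by rewrite cocycleM_Ker => ->; rewrite val1 mul1g.
Qed.

(** The maps [q] and [dagger q] read off the two factors of a product [a * b], which gives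
    uniqueness. *)
Lemma cocycle_factorization : factorization (target q) (KerC q).
Proof.
apply: factorizationI => [m|a a' b b' eqab].
  by exists (q m), (dagger q m); exact: cocycle_dagger.
have := congr1 (mapq q) eqab; have := congr1 (dagger q) eqab.
by rewrite !cocycleM_Ker !daggerM_Ker.
Qed.

Definition factorization_of_cocycle : lnFactorization M :=
  @LNFactorization M (target q, KerC q) cocycle_factorization
    (@cocycle_left_normal M q) (@lnCocycle_group M q).

Lemma lproj_KerC : MapToSub (lproj (target q) (KerC q)) = cocycle_map q.
Proof.
have -> : lproj (target q) (KerC q) = mapq q; last by case: (cocycle_map q).
apply/funext=> m; rewrite {1}(cocycle_dagger m) lprojM //.
exact: cocycle_factorization.
Qed.

Lemma dagger_val (b : submon (KerC q)) : dagger q (val b) = b.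
Proof. by rewrite -{1}[val b]mul1g -(val1 (submon (target q))) daggerM_Ker. Qed.

Lemma dagger_morphism : monoid_morphism (dagger q).
Proof.
split=> [|m1 m2]; first by rewrite -(val1 (submon (KerC q))) dagger_val.
have [a eq_a] :=
  left_normalP (q m2) (@cocycle_left_normal M q) (valP (dagger q m1)).
rewrite {1}(cocycle_dagger m1) {1}(cocycle_dagger m2).
(* With [a1 = q m1] and [a2 = q m2], the relation [b1 * a2 = a * b1] turns [a1 * b1 * a2 * b2] into
   [(a1 * a) * (b1 * b2)], whose kernel part is [b1 * b2]. *)
move: (dagger q m1) (dagger q m2) eq_a => b1 b2 eq_a.
rewrite mulgA -(mulgA (val (q m1))) eq_a mulgA -valM -mulgA -valM.
exact: daggerM_Ker.
Qed.

Lemma Ker_dagger : Ker (dagger q) =i target q.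
Proof.
move=> m; rewrite unfold_in /=; apply/eqP/idP => [dm1|mA].
  by rewrite (cocycle_dagger m) dm1 val1 mulg1; exact: valP.
rewrite -[m](SubK (submon (target q)) mA) -[val _]mulg1.
by rewrite -(val1 (submon (KerC q))) daggerM_Ker.
Qed.

Lemma dagger_split_epi : split_epi (dagger q) (val : submon (KerC q) -> M).
Proof.
split; first exact: dagger_morphism.
  by split=> [|x y]; [exact: val1 | exact: valM].
exact: dagger_val.
Qed.

Lemma dagger_torsor : kernel_torsor (dagger q).
Proof.
move=> m1 m2 eqd; have [iq qi] := cocycle_invV m1.
(* Since [m1] and [m2] have the same kernel part, they differ only by their group parts. *)
exists (val (q m2 * cocycle_inv q m1)); split.
  split; first by rewrite Ker_dagger; exact: valP.
  rewrite [X in _ = _ * X]cocycle_dagger mulgA -valM.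
  rewrite -(mulgA (q m2)) iq mulg1 eqd.
  exact: cocycle_dagger.
(* Applying [q] to [m2 = k * m1] gives [q m2 = k * q m1], which determines [k]. *)
move=> k []; rewrite Ker_dagger => kA ->; rewrite -[k](SubK (submon _) kA).
have [_ qM _] := lnCocycleP q.
by rewrite qM -mulgA qi mulg1.
Qed.

Definition split_of_cocycle : splitEpi M :=
  @SplitEpi M (SplitData (dagger q) val) dagger_split_epi dagger_torsor.

End Cocycle.

(** * The factorization and the cocycle of a split epimorphism *)

Section SplitEpi.
Variables (M : monoidType) (e : splitEpi M).
Local Notation p := (proj e).
Local Notation s := (sect e).

Let pM : {morph p : x y / x * y}.
Proof. by have [[]] := splitEpiP e. Qed.

Let p1 : p 1 = 1.
Proof. by have [[]] := splitEpiP e. Qed.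

Let sK : cancel s p.
Proof. by have [] := splitEpiP e. Qed.

Lemma splitEpi_torsor : kernel_torsor p.
Proof. by case: e. Qed.

Lemma KerPE (k : submon (KerP e)) : p (val k) = 1.
Proof. by apply/eqP; exact: (valP k). Qed.

Lemma sect_ImS (b : base e) : s b \in ImS e.
Proof. by apply/asboolP; exists b. Qed.

Lemma ImSP (m : M) : m \in ImS e -> s (p m) = m.
Proof. by move=> /asboolP[b _ <-]; rewrite sK. Qed.

Lemma KerP_translate (m1 m2 : M) :
  p m1 = p m2 -> exists k : submon (KerP e), m2 = val k * m1.
Proof. by move=> /splitEpi_torsor[k [[kK ->] _]]; exists (Sub k kK). Qed.

(** Both elements carry [m] to the same point of its fibre, and the torsor condition allows only one
    such translation. *)
Lemma KerP_translate_inj (k k' : submon (KerP e)) (m : M) :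
  val k * m = val k' * m -> k = k'.
Proof.
move=> eqk; have [|k0 [_ k0_uniq]] := @splitEpi_torsor m (val k * m).
  by rewrite pM KerPE mul1g.
apply: val_inj; rewrite -(k0_uniq (val k)) ?(k0_uniq (val k')) //.
  by split; [exact: valP|].
by split; [exact: valP|].
Qed.

Lemma KerP_factorization : factorization (KerP e) (ImS e).
Proof.
apply: factorizationI => [m|a a' b b' eqab].
  have [|k eq_m] := @KerP_translate (s (p m)) m; first by rewrite sK.
  by exists k, (Sub (s (p m)) (sect_ImS _)); rewrite SubK.
(* Applying [p] kills the kernel factors, and [s] recovers an element of its image from its value
   under [p]. *)
have eqb : b = b'.
  apply: val_inj; rewrite -(ImSP (valP b)) -(ImSP (valP b')).
  by have := congr1 p eqab; rewrite !pM !KerPE !mul1g => ->.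
by split=> //; apply: (@KerP_translate_inj _ _ (val b)); rewrite eqab eqb.
Qed.

(** For [n] in the kernel, [x * n] lies in the fibre of [x], hence is a kernel translate [k * x]. *)
Lemma KerP_left_normal : left_normal (ImS e) (KerP e).
Proof.
move=> x _ _ [n nK <-].
have [|k ->] := @KerP_translate x (x * n).
  by rewrite pM; move: nK => /= /eqP ->; rewrite mulg1.
by exists (val k) => //; exact: (valP k).
Qed.

Lemma KerP_group : is_group (submon (KerP e)).
Proof.
have ex_linv (x : submon (KerP e)) : exists y, y * x = 1.
  (* Both [x] and [1] lie in the fibre over [1], so some kernel element translates [x] to [1]. *)
  have [|y eqy] := @KerP_translate (val x) 1; first by rewrite KerPE p1.
  by exists y; apply: val_inj; rewrite valM val1 -eqy.
move=> x; have [y yx] := ex_linv x; have [z zy] := ex_linv y.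
(* The left inverse of [y] is [x] itself, so [y] is a two-sided inverse. *)
have eqzx : z = x by rewrite -[z]mulg1 -yx mulgA zy mul1g.
by exists y; split=> //; rewrite -{1}eqzx.
Qed.

Definition factorization_of_split : lnFactorization M :=
  @LNFactorization M (KerP e, ImS e) KerP_factorization KerP_left_normal
    KerP_group.

(** Passing through the factorization reduces later equalities of cocycles to equalities of two
    pairs of submonoids. *)
Definition cocycle_of_split : lnCocycle M :=
  cocycle_of_factorization factorization_of_split.

(** The kernel of the cocycle is the image of [s], on which [p] restricts to an isomorphism with
    inverse [s]. *)
Lemma split_iso_of_cocycle_of_split :
  split_iso (split_of_cocycle cocycle_of_split) e.
Proof.
have KerCE m : (m \in KerC cocycle_of_split) = (m \in ImS e).
  exact: (Ker_lproj KerP_factorization).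
have sKer b : s b \in KerC cocycle_of_split by rewrite KerCE sect_ImS.
have ps (b : submon (KerC cocycle_of_split)) : s (p (val b)) = val b.
  by apply: ImSP; rewrite -KerCE; exact: valP.
exists (fun b => p (val b)); split=> //=.
- exists (fun b => Sub (s b) (sKer b)) => [b|b]; last exact: sK.
  by apply: val_inj; exact: ps.
- by split=> [|x y]; [exact: p1 | exact: pM].
(* The factor [(q m)^-1] of [dagger q m] lies in the kernel of [p]. *)
- by move=> m; rewrite pM KerPE mul1g.
Qed.

End SplitEpi.

(** * Round trips between the three structures *)

Lemma cocycle_of_factorizationK (M : monoidType) :
  cancel (@cocycle_of_factorization M) (@factorization_of_cocycle M).
Proof.
case=> -[A B] fAB nAB gA; apply: lnFactorization_ext => /=; congr pair.
by apply: umagmaClosed_ext; exact: (Ker_lproj fAB).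
Qed.

Lemma factorization_of_cocycleK (M : monoidType) :
  cancel (@factorization_of_cocycle M) (@cocycle_of_factorization M).
Proof. by move=> q; apply: lnCocycle_ext; exact: lproj_KerC. Qed.

Lemma split_of_cocycleK (M : monoidType) :
  cancel (@split_of_cocycle M) (@cocycle_of_split M).
Proof.
(* With [q] written as the cocycle of its own factorization, it remains to compare factors: the
   kernel of [dagger q] is [target q], and the inclusion has image [KerC q]. *)
move=> q; rewrite -[RHS]factorization_of_cocycleK /cocycle_of_split.
congr cocycle_of_factorization; apply: lnFactorization_ext; congr pair.
  by apply: umagmaClosed_ext; exact: Ker_dagger.
apply: umagmaClosed_ext => m; apply/asboolP/idP => [[b _ <-]|mK].
  exact: (valP (b : submon (KerC q))).
by exists (Sub m mK : submon (KerC q)) => //; exact: SubK.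
Qed.

(** * Isomorphism of split epimorphisms and the full correspondence *)

Lemma split_iso_sym (M : monoidType) (e e' : splitEpi M) :
  split_iso e e' -> split_iso e' e.
Proof.
move=> [phi [[psi phiK psiK] [phi1 phiM] phi_p phi_s]].
exists psi; split; first by exists phi.
- by split=> [|x y]; apply: (can_inj phiK); rewrite ?phiM !psiK.
- by move=> m; rewrite -phi_p phiK.
- by move=> b; rewrite -phi_s psiK.
Qed.

Lemma split_iso_trans (M : monoidType) (e2 e1 e3 : splitEpi M) :
  split_iso e1 e2 -> split_iso e2 e3 -> split_iso e1 e3.
Proof.
move=> [f [f_bij [f1 fM] f_p f_s]] [g [g_bij [g1 gM] g_p g_s]].
exists (g \o f); split; first exact: bij_comp.
- by split=> [|x y] /=; rewrite ?f1 ?g1 ?fM ?gM.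
- by move=> m /=; rewrite f_p g_p.
- by move=> b /=; rewrite g_s f_s.
Qed.

(** An isomorphism compatible with [p] and [s] preserves both the kernel of [p] and the image of
    [s], and these determine the cocycle. *)
Lemma cocycle_of_split_iso (M : monoidType) (e e' : splitEpi M) :
  split_iso e e' -> cocycle_of_split e = cocycle_of_split e'.
Proof.
move=> [f [f_bij [f1 _] f_p f_s]]; rewrite /cocycle_of_split.
have [g fK gK] := f_bij.
congr cocycle_of_factorization; apply: lnFactorization_ext; congr pair.
  apply: umagmaClosed_ext => m.
  have -> : (m \in KerP e') = (proj e' m == 1) by [].
  by rewrite -f_p -f1 (can_eq fK).
apply: umagmaClosed_ext => m; apply/asboolP/asboolP => -[b _ <-].
  by exists (f b).
by exists (g b) => //; rewrite -f_s gK.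
Qed.

Theorem theorem3p6 (M : monoidType) :
  exists (toCocycle : lnFactorization M -> lnCocycle M)
         (toFactorization : lnCocycle M -> lnFactorization M)
         (toSplit : lnCocycle M -> splitEpi M)
         (ofSplit : splitEpi M -> lnCocycle M),
    [/\ [/\ forall f : lnFactorization M,
              cocycle_map (toCocycle f)
              = MapToSub (lproj (factors f).1 (factors f).2),
            forall q : lnCocycle M,
              factors (toFactorization q) = (target q, KerC q),
            cancel toCocycle toFactorization
          & cancel toFactorization toCocycle]
      & [/\ forall q : lnCocycle M,
              split_data (toSplit q)
              = SplitData (dagger q) (val : submon (KerC q) -> M),
            forall e : splitEpi M,
              cocycle_map (ofSplit e) = MapToSub (lproj (KerP e) (ImS e)),
            cancel toSplit ofSplit,
            forall e : splitEpi M, split_iso (toSplit (ofSplit e)) e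
          & forall e e' : splitEpi M,
              ofSplit e = ofSplit e' <-> split_iso e e']].
Proof.
exists (@cocycle_of_factorization M), (@factorization_of_cocycle M),
  (@split_of_cocycle M), (@cocycle_of_split M).
split; split=> //.
- exact: cocycle_of_factorizationE.
- exact: cocycle_of_factorizationK.
- exact: factorization_of_cocycleK.
- exact: split_of_cocycleK.
- exact: split_iso_of_cocycle_of_split.
(* Split epimorphisms with equal cocycles are both isomorphic to the one rebuilt from that
   cocycle. *)
- move=> e e'; split=> [eqq|]; last exact: cocycle_of_split_iso.
  apply: split_iso_trans (split_iso_of_cocycle_of_split e').
  by rewrite -eqq; apply: split_iso_sym; exact: split_iso_of_cocycle_of_split.
Qed.
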